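(* Let $\mathcal{L} = (G, a_0, I, \theta)$ be a ladget with $G=(V,E)$. Then: (1) $\deg(\theta) \ge 2$; (2) if $\mathcal{L}$ is minimal, then every internal vertex $v \in V\setminus(I\cup\{a_0,\theta\})$ satisfies $\deg(v)\ge 3$.
   Context: A ladget is a tuple $\mathcal{L}=(G,a_0,I,\theta)$ where $G=(V,E)$ is a finite simple graph, $a_0\in V$ is the anchor vertex, $I=(i_1,\dots,i_n)$ with $n\ge 1$ is an ordered tuple of distinct input vertices, and $\theta\in V$ is the output vertex, with $a_0$, the inputs and $\theta$ pairwise distinct. A valid 3-coloring is a proper coloring $c:V\to\{0,1,2\}$ (adjacent vertices get distinct colors) with $c(a_0)=0$. A vertex has Boolean value $0$ if its color is $0$ and Boolean value $1$ if its color is in $\{1,2\}$. $\mathcal{L}$ is required to implement a Boolean function $\varphi_{\mathcal{L}}:\{0,1\}^n\to\{0,1\}$ that depends on every input, meaning: (Universality) every assignment of colors from $\{0,1,2\}$ to the input vertices extends to a valid 3-coloring; (Consistency) in every valid 3-coloring, the Boolean value of $\theta$ equals $\varphi_{\mathcal{L}}$ applied to the Boolean values of $i_1,\dots,i_n$. The order of $\mathcal{L}$ is $|V|$. $\mathcal{L}$ is minimal if no ladget implementing the same Boolean function $\varphi_{\mathcal{L}}$ has strictly smaller order. *)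

(* Defs.v *)
From mathcomp Require Import all_boot.

Set Implicit Arguments.
Unset Strict Implicit.
Unset Printing Implicit Defensive.

Record sgraph := SGraph {
  vertex :> finType;
  adj : rel vertex;
  adj_sym : symmetric adj;
  adj_irr : irreflexive adj
}.

Definition deg (G : sgraph) (v : G) : nat := #|[set w | adj v w]|.

Definition proper_coloring (G : sgraph) (c : G -> 'I_3) : Prop :=
  forall u v : G, adj u v -> c u != c v.

(* [false] and [true] are the Boolean values 0 and 1. *)
Definition bval (k : 'I_3) : bool := k != ord0.

(* The tuple (G, a_0, I, theta) with its non-semantic requirements. *)
Record frame (n : nat) := Frame {
  graph :> sgraph;
  anchor : graph;
  inputs : n.-tuple graph;
  output : graph;
  inputs_gt0 : 0 < n;
  frame_uniq : uniq (anchor :: output :: inputs)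
}.

Definition valid_coloring n (L : frame n) (c : L -> 'I_3) : Prop :=
  proper_coloring c /\ c (anchor L) = ord0.

Definition depends_on_every_input n (phi : n.-tuple bool -> bool) : Prop :=
  forall i : 'I_n, exists x y : n.-tuple bool,
    (forall j : 'I_n, j != i -> tnth x j = tnth y j) /\ phi x <> phi y.

Definition universal n (L : frame n) : Prop :=
  forall k : 'I_n -> 'I_3, exists c : L -> 'I_3,
    valid_coloring c /\ forall i : 'I_n, c (tnth (inputs L) i) = k i.

Definition consistent n (L : frame n) (phi : n.-tuple bool -> bool) : Prop :=
  forall c : L -> 'I_3, valid_coloring c ->
    bval (c (output L)) = phi [tuple bval (c (tnth (inputs L) i)) | i < n].

Definition implements n (L : frame n) (phi : n.-tuple bool -> bool) : Prop :=
  [/\ depends_on_every_input phi, universal L & consistent L phi].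

(* The function is stored as data, but universality and consistency determine
   it pointwise from the underlying tuple: see [implements_unique]. *)
Record ladget (n : nat) := Ladget {
  ladget_frame :> frame n;
  ladget_fun : n.-tuple bool -> bool;
  ladget_implements : implements ladget_frame ladget_fun
}.

Lemma implements_unique n (L : frame n) (phi psi : n.-tuple bool -> bool) :
  implements L phi -> implements L psi -> phi =1 psi.
Proof.
move=> [_ univ cphi] [_ _ cpsi] x.
pose k (i : 'I_n) : 'I_3 := if tnth x i then ord_max else ord0.
have [c [vc ck]] := univ k.
suff <- : [tuple bval (c (tnth (inputs L) i)) | i < n] = x.
  by rewrite -cphi // -cpsi.
by apply: eq_from_tnth => i; rewrite tnth_mktuple ck /k; case: (tnth x i).
Qed.

Definition ladget_order n (L : ladget n) : nat := #|vertex L|.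

Definition minimal n (L : ladget n) : Prop :=
  ~ exists L' : ladget n,
    ladget_fun L' =1 ladget_fun L /\ ladget_order L' < ladget_order L.

Definition internal n (L : ladget n) (v : L) : Prop :=
  [/\ v \notin inputs L, v <> anchor L & v <> output L].

(* Main.v *)
(** A vertex can be recolored with any color that its neighbors avoid.  If
    [deg (output L) <= 1], then in a coloring where the output has color 0 some
    nonzero color is still free for the output, so [phi] never takes the value
    0 and cannot depend on its inputs.  If an internal [v] has degree at most 2,
    every valid coloring of [G - v] extends to [G], so [G - v] implements the
    same function. *)
Require Import Defs.
From mathcomp Require Import all_boot.

Set Implicit Arguments.
Unset Strict Implicit.
Unset Printing Implicit Defensive.

Definition neighbors (G : sgraph) (v : G) : {set G} := [set w | adj v w].

Definition recolor (G : sgraph) (c : G -> 'I_3) (v : G) (k : 'I_3) : G -> 'I_3 :=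
  fun x => if x == v then k else c x.

Lemma recolor_neq (G : sgraph) (c : G -> 'I_3) v k x :
  x != v -> recolor c v k x = c x.
Proof. by rewrite /recolor => /negbTE ->. Qed.

Lemma recolor_eq (G : sgraph) (c : G -> 'I_3) v k : recolor c v k v = k.
Proof. by rewrite /recolor eqxx. Qed.

(** Edges at [v] are handled by the choice of [k], all others by [c]. Properness of [c] is asked
    only away from [v], so that [c] may also be a coloring of [G - v] with an arbitrary value at
    [v]. *)
Lemma recolor_proper (G : sgraph) (c : G -> 'I_3) (v : G) (k : 'I_3) :
  (forall x y, x != v -> y != v -> adj x y -> c x != c y) ->
  k \notin c @: neighbors v -> proper_coloring (recolor c v k).
Proof.
move=> cP kN.
have kP y : adj v y -> k != c y.
  by move=> vy; apply: contraNneq kN => ->; rewrite imset_f ?inE.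
move=> x y; rewrite /recolor.
have [-> | xv] := eqVneq x v; have [-> | yv] := eqVneq y v.
- by rewrite adj_irr.
- exact: kP.
- by rewrite adj_sym eq_sym; apply: kP.
- exact: cP.
Qed.

Lemma free_color (A : {set 'I_3}) : #|A| < 3 -> exists k, k \notin A.
Proof.
move=> ltA; have /set0Pn[k] : ~: A != set0.
  by rewrite -card_gt0 -(ltn_add2l #|A|) addn0 cardsC card_ord.
by rewrite inE; exists k.
Qed.

Lemma anchor_neq_output n (L : frame n) : anchor L != output L.
Proof. by have := frame_uniq L; rewrite /= inE negb_or => /andP[/andP[]]. Qed.

Lemma input_neq_output n (L : frame n) i : tnth (inputs L) i != output L.
Proof.
have /= /and3P[_ oI _] := frame_uniq L.
by apply: contraNneq oI => <-; apply: mem_tnth.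
Qed.

Lemma depends_on_every_input_false n (phi : n.-tuple bool -> bool) :
  0 < n -> depends_on_every_input phi -> exists x, phi x = false.
Proof.
move=> n_gt0 /(_ (Ordinal n_gt0))[x [y [_ neq_phi]]].
case phix: (phi x); last by exists x.
by exists y; apply/negP=> phiy; apply: neq_phi; rewrite phix phiy.
Qed.

Lemma universal_bval n (L : frame n) (x : n.-tuple bool) : universal L ->
  exists2 c : L -> 'I_3, valid_coloring c &
    [tuple bval (c (tnth (inputs L) i)) | i < n] = x.
Proof.
(* Any nonzero color represents the Boolean value 1; [ord_max] is color 2. *)
move=> /(_ (fun i => if tnth x i then ord_max else ord0))[c [cv ck]].
exists c => //; apply: eq_from_tnth => i.
by rewrite tnth_mktuple ck; case: (tnth x i).
Qed.

Lemma deg_output n (L : ladget n) : 2 <= deg (output L).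
Proof.
case: (ladget_implements L) => dep univ cons; rewrite leqNgt; apply/negP => lt2.
have [x phix] := depends_on_every_input_false (inputs_gt0 L) dep.
have [c [cP ca] cx] := universal_bval x univ.
(* Color 0 is excluded as well, so that the new color has Boolean value 1. With at most one
   neighbor, at most two of the three colors are forbidden. *)
have [k] : exists k, k \notin ord0 |: c @: neighbors (output L).
  apply: free_color; apply: leq_ltn_trans (_ : _ <= 1 + 1) _ => //.
  rewrite cardsU1; apply: leq_add; first exact: leq_b1.
  exact: leq_trans (leq_imset_card _ _) lt2.
rewrite !inE negb_or => /andP[k0 kN].
pose d := recolor c (output L) k.
have dv : valid_coloring d.
  split; last by rewrite /d recolor_neq ?anchor_neq_output.
  by apply: recolor_proper => // y z _ _; apply: cP.
have dx : [tuple bval (d (tnth (inputs L) i)) | i < n] = x.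
  rewrite -cx; apply: eq_from_tnth => i.
  by rewrite !tnth_mktuple /d recolor_neq ?input_neq_output.
(* The inputs kept their colors, so consistency requires Boolean value 0 at the output, whose color
   [k] is nonzero. *)
by have := cons d dv; rewrite dx phix /d recolor_eq /bval k0.
Qed.

Section DeleteVertex.

Variables (G : sgraph) (v : G).

Let V := {x : G | x != v}.

Let delete_adj : rel V := fun x y => adj (val x) (val y).

Fact delete_adj_sym : symmetric delete_adj.
Proof. by move=> x y; apply: adj_sym. Qed.

Fact delete_adj_irr : irreflexive delete_adj.
Proof. by move=> x; apply: adj_irr. Qed.

Definition delete_vertex : sgraph := SGraph delete_adj_sym delete_adj_irr.

Lemma card_delete_vertex : #|vertex delete_vertex| < #|vertex G|.
Proof.
rewrite [X in X < _]card_sig [X in _ < X](cardD1 v) inE add1n ltnS.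
by apply: subset_leq_card; apply/subsetP=> x; rewrite !inE andbT.
Qed.

Lemma delete_vertex_coloring (c : delete_vertex -> 'I_3) :
  deg v < 3 -> proper_coloring c ->
  exists2 d : G -> 'I_3, proper_coloring d & forall x : V, d (val x) = c x.
Proof.
move=> lt3 cP.
(* The default [ord0] is taken only at [v], which is not its own neighbor and gets recolored. *)
pose c0 (x : G) : 'I_3 := if (insub x : option V) is Some y then c y else ord0.
have c0E (x : V) : c0 (val x) = c x by rewrite /c0 valK.
have [k kN] := free_color (leq_ltn_trans (leq_imset_card c0 (neighbors v)) lt3).
exists (recolor c0 v k); last by move=> x; rewrite recolor_neq ?(valP x).
apply: recolor_proper => // x y xv yv xy.
by rewrite (c0E (Sub x xv)) (c0E (Sub y yv)); apply: cP.
Qed.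

End DeleteVertex.

Section DeleteInternal.

Variables (n : nat) (L : frame n) (v : L).
Hypotheses (av : anchor L != v) (ov : output L != v).
Hypothesis iv : forall i, tnth (inputs L) i != v.

Let keep (x : L) (xv : x != v) : delete_vertex v := exist (fun x => x != v) x xv.
Let delete_inputs : n.-tuple (delete_vertex v) := [tuple keep (iv i) | i < n].

Fact delete_frame_uniq :
  uniq [:: keep av, keep ov & delete_inputs].
Proof.
(* The injection [val] carries the list back to the anchor, output and inputs of [L]. *)
rewrite -(map_inj_uniq val_inj) /= -map_comp.
rewrite (_ : map _ _ = inputs L); first exact: frame_uniq.
exact: map_tnth_enum.
Qed.

Definition delete_frame : frame n :=
  @Frame n (delete_vertex v) _ delete_inputs _ (inputs_gt0 L) delete_frame_uniq.

Lemma delete_frame_implements phi :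
  deg v < 3 -> implements L phi -> implements delete_frame phi.
Proof.
move=> lt3 [dep univ cons]; split=> // [k | c [cP ca]].
  (* Universality: restrict a coloring of [L] to [G - v]. *)
  have [c [[cP ca] ck]] := univ k.
  exists (fun x => c (val x)); split; last by move=> i; rewrite tnth_mktuple ck.
  by split=> // x y; apply: cP.
(* Consistency: extend the coloring to [v]; the anchor, inputs and output differ from [v] and keep
   their colors. *)
have [d dP dE] := delete_vertex_coloring lt3 cP.
rewrite -dE /= cons; last by split; rewrite // -ca -dE.
congr phi; apply: eq_from_tnth => i.
by rewrite !tnth_mktuple -dE.
Qed.

End DeleteInternal.

Lemma minimal_deg_internal n (L : ladget n) (v : L) :
  minimal L -> internal v -> 3 <= deg v.
Proof.
move=> Lmin [vI /eqP va /eqP vo]; rewrite leqNgt; apply/negP => lt3; apply: Lmin.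
have iv i : tnth (inputs L) i != v.
  by apply: contraNneq vI => <-; apply: mem_tnth.
rewrite eq_sym in va; rewrite eq_sym in vo.
exists (Ladget (delete_frame_implements va vo iv lt3 (ladget_implements L))).
by split=> //; apply: card_delete_vertex.
Qed.

Theorem mainTheorem7 (n : nat) (L : ladget n) :
  2 <= deg (output L) /\
  (minimal L -> forall v : L, internal v -> 3 <= deg v).
Proof.
split; first exact: deg_output.
by move=> Lmin v; apply: minimal_deg_internal.
Qed.
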